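(* Let $R$ be a $G$-graded ring with unity and let $P$ be a proper graded ideal of $R$. If $P$ is a graded weakly prime ideal of $R$, then $P$ is a graded weakly $2$-absorbing ideal of $R$.
   Context: Rings are associative and not necessarily commutative; ''ideal'' means two-sided ideal. $G$ is a group with identity $e$. A ring $R$ is $G$-graded if $R=\bigoplus_{g\in G}R_g$ with each $R_g$ an additive subgroup and $R_gR_h\subseteq R_{gh}$ for all $g,h\in G$; $h(R)=\bigcup_{g\in G}R_g$ is the set of homogeneous elements. An ideal $P$ of $R$ is graded if $P=\bigoplus_{g\in G}(P\cap R_g)$. A proper graded ideal $P$ of $R$ is graded weakly prime if whenever $I,J$ are graded ideals of $R$ with $0\neq IJ\subseteq P$, then $I\subseteq P$ or $J\subseteq P$. A proper graded ideal $P$ of $R$ is graded weakly $2$-absorbing if for all $x,y,z\in h(R)$, $0\neq xRyRz\subseteq P$ implies $xy\in P$ or $yz\in P$ or $xz\in P$. Here $xRyRz$ is the set (or additive subgroup generated by) all products $xrysz$ with $r,s\in R$, and $0\neq xRyRz$ means $xRyRz\neq\{0\}$. *)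

(* Defs.v *)
From mathcomp Require Import all_boot all_algebra.
From mathcomp Require Import boolp classical_sets.

Set Implicit Arguments.
Unset Strict Implicit.
Unset Printing Implicit Defensive.

Import GRing.Theory.

Local Open Scope classical_set_scope.
Local Open Scope ring_scope.

Definition additive_subgroup (V : zmodType) (A : set V) : Prop :=
  0 \in A /\ forall x y : V, x \in A -> y \in A -> x - y \in A.

(* [s] is the finite set of indices of the possibly nonzero components. *)
Definition internal_direct_sum (I : eqType) (V : zmodType)
    (A : set V) (B : I -> set V) : Prop :=
  [/\ additive_subgroup A,
      forall i, additive_subgroup (B i) /\ B i `<=` A,
      forall a, a \in A -> exists (s : seq I) (f : I -> V),
        [/\ uniq s, forall i, f i \in B i & a = \sum_(i <- s) f i]
    & forall (s : seq I) (f : I -> V),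
        uniq s -> (forall i, f i \in B i) -> \sum_(i <- s) f i = 0 ->
        {in s, forall i, f i = 0}].

Definition two_sided_ideal (R : pzRingType) (I : set R) : Prop :=
  additive_subgroup I /\
  forall r x : R, x \in I -> r * x \in I /\ x * r \in I.

Definition ideal_product (R : pzRingType) (I J : set R) : set R :=
  smallest (@additive_subgroup R) [set x * y | x in I & y in J].

Section Graded.
Variables (G : groupType) (R : pzRingType) (gr : G -> set R).

Definition is_grading : Prop :=
  internal_direct_sum [set: R] gr /\
  forall (g h : G) (x y : R),
    x \in gr g -> y \in gr h -> x * y \in gr (g * h)%g.

Definition homogeneous : set R := \bigcup_g gr g.

Definition graded_ideal (P : set R) : Prop :=
  two_sided_ideal P /\ internal_direct_sum P (fun g => P `&` gr g).

Definition proper_graded_ideal (P : set R) : Prop :=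
  graded_ideal P /\ P <> [set: R].

Definition graded_weakly_prime (P : set R) : Prop :=
  proper_graded_ideal P /\
  forall I J : set R, graded_ideal I -> graded_ideal J ->
    ideal_product I J <> [set 0] -> ideal_product I J `<=` P ->
    I `<=` P \/ J `<=` P.

Definition triple_product (x y z : R) : set R :=
  [set x * r * y * s * z | r in [set: R] & s in [set: R]].

Definition graded_weakly_2_absorbing (P : set R) : Prop :=
  proper_graded_ideal P /\
  forall x y z : R,
    x \in homogeneous -> y \in homogeneous -> z \in homogeneous ->
    triple_product x y z <> [set 0] -> triple_product x y z `<=` P ->
    [\/ x * y \in P, y * z \in P | x * z \in P].

End Graded.

(* Main.v *)
Require Import Defs.
From mathcomp Require Import all_boot all_algebra.
From mathcomp Require Import boolp classical_sets.

(** Let [x], [y], [z] be homogeneous with [0 <> xRyRz] contained in [P].  Take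
    [I], the ideal generated by [x], and [J], the ideal generated by the
    elements [y s z] with [s] homogeneous.  Both are generated by homogeneous
    elements, hence graded ([graded_ideal_gen]), and [J] contains the whole of
    [yRz] because every [s] is a sum of homogeneous elements.  Since [P] is an
    ideal containing [xRyRz], it contains the product [IJ]
    ([ideal_gen_mul_sub]); since [x r] is in [I] and [y s z] in [J], the product
    [IJ] contains [xRyRz], so it is nonzero.  Weak primeness now gives
    [I <= P], so that [x], and with it [x y], lies in [P]; or [J <= P], so that
    [y z = y 1 z] lies in [P]. *)

Set Implicit Arguments.
Unset Strict Implicit.
Unset Printing Implicit Defensive.

Import GRing.Theory.

Local Open Scope classical_set_scope.
Local Open Scope ring_scope.

Section AdditiveSubgroup.
Variables (V : zmodType) (A : set V).
Hypothesis hA : additive_subgroup A.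

Lemma additive_subgroup0 : A 0.
Proof. by case: hA; rewrite inE. Qed.

Lemma additive_subgroupB a b : A a -> A b -> A (a - b).
Proof. by case: hA => _ hB Aa Ab; have := hB a b; rewrite !inE; apply. Qed.

Lemma additive_subgroupD a b : A a -> A b -> A (a + b).
Proof.
move=> Aa Ab; rewrite -[b]opprK -[- b]sub0r; apply: additive_subgroupB => //.
exact: additive_subgroupB additive_subgroup0 Ab.
Qed.

Lemma additive_subgroup_sum (I : Type) (s : seq I) (f : I -> V) :
  (forall i, A (f i)) -> A (\sum_(i <- s) f i).
Proof.
move=> Af; apply: big_ind => //; first exact: additive_subgroup0.
exact: additive_subgroupD.
Qed.

End AdditiveSubgroup.

Lemma additive_subgroupI (V : zmodType) (A B : set V) :
  additive_subgroup A -> additive_subgroup B -> additive_subgroup (A `&` B).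
Proof.
move=> hA hB; split=> [|a b]; rewrite !inE.
  by split; exact: additive_subgroup0.
by move=> [Aa Ba] [Ab Bb]; split; exact: additive_subgroupB.
Qed.

Section TwoSidedIdeal.
Variables (R : pzRingType) (I : set R).
Hypothesis hI : two_sided_ideal I.

Lemma two_sided_idealMl r a : I a -> I (r * a).
Proof. by case: hI => _ hM Ia; have := hM r a; rewrite !inE => /(_ Ia)[]. Qed.

Lemma two_sided_idealMr r a : I a -> I (a * r).
Proof. by case: hI => _ hM Ia; have := hM r a; rewrite !inE => /(_ Ia)[]. Qed.

End TwoSidedIdeal.

Lemma two_sided_idealP (R : pzRingType) (I : set R) :
  I 0 -> (forall a b, I a -> I b -> I (a - b)) ->
  (forall r a, I a -> I (r * a)) -> (forall r a, I a -> I (a * r)) ->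
  two_sided_ideal I.
Proof.
move=> I0 IB Il Ir; split; first by split=> [|a b]; rewrite !inE //; exact: IB.
by move=> r a; rewrite !inE => Ia; split; [exact: Il|exact: Ir].
Qed.

(** * Generated ideals *)

Definition ideal_gen (R : pzRingType) (A : set R) : set R :=
  smallest (@two_sided_ideal R) A.

Lemma ideal_gen_ideal (R : pzRingType) (A : set R) :
  two_sided_ideal (ideal_gen A).
Proof.
apply: two_sided_idealP => [|a b ha hb|r a ha|r a ha] M hM.
- by case: hM => -[hM _] _; exact: additive_subgroup0.
- by have [[hM' _] _] := hM; apply: additive_subgroupB => //; [exact: ha|exact: hb].
- by have [hM' _] := hM; apply: two_sided_idealMl => //; exact: ha.
- by have [hM' _] := hM; apply: two_sided_idealMr => //; exact: ha.
Qed.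

Lemma sub_ideal_gen (R : pzRingType) (A : set R) : A `<=` ideal_gen A.
Proof. exact: sub_gen_smallest. Qed.

Lemma ideal_gen_sub (R : pzRingType) (A M : set R) :
  two_sided_ideal M -> A `<=` M -> ideal_gen A `<=` M.
Proof. exact: smallest_sub. Qed.

(** The elements [a] with [a (B) <= P] form an ideal, and so do the elements [b]
    with [A R b <= P]; hence it is enough to test generators, provided that an
    arbitrary ring element is allowed between them. *)
Lemma ideal_gen_mul_sub (R : pzRingType) (A B P : set R) :
  two_sided_ideal P ->
  (forall a r b, A a -> B b -> P (a * r * b)) ->
  ideal_product (ideal_gen A) (ideal_gen B) `<=` P.
Proof.
move=> hP hAB; have [hP' _] := hP.
have hAJ : ideal_gen B `<=` [set b | forall a r, A a -> P (a * r * b)].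
  apply: ideal_gen_sub => [|b Bb a r Aa]; last exact: hAB.
  apply: two_sided_idealP => [a r _|b b' hb hb' a r Aa|t b hb a r Aa
    |t b hb a r Aa].
  - by rewrite mulr0; exact: additive_subgroup0.
  - by rewrite mulrBr; apply: additive_subgroupB => //; [exact: hb|exact: hb'].
  - by rewrite mulrA -[a * r * t]mulrA; exact: hb.
  - by rewrite mulrA; apply: two_sided_idealMr => //; exact: hb.
have hIJ : ideal_gen A `<=` [set a | forall b, ideal_gen B b -> P (a * b)].
  apply: ideal_gen_sub => [|a Aa b Bb].
  - apply: two_sided_idealP => [b _|a a' ha ha' b Bb|t a ha b Bb|t a ha b Bb].
    + by rewrite mul0r; exact: additive_subgroup0.
    + by rewrite mulrBl; apply: additive_subgroupB => //; [exact: ha|exact: ha'].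
    + by rewrite -mulrA; apply: two_sided_idealMl => //; exact: ha.
    + rewrite -mulrA; apply: ha.
      exact: (two_sided_idealMl (ideal_gen_ideal B)).
  - by have := hAJ _ Bb a 1 Aa; rewrite mulr1.
apply: smallest_sub => // _ [a Ia [b Jb <-]]; exact: hIJ.
Qed.

(** * Gradings *)

Section Grading.
Variables (G : groupType) (R : pzRingType) (gr : G -> set R).
Hypothesis hR : is_grading gr.

Lemma grading_additive g : additive_subgroup (gr g).
Proof. by case: hR => -[_ /(_ g)[]]. Qed.

Lemma grading_decomp a :
  exists (s : seq G) (f : G -> R),
    (forall g, gr g (f g)) /\ a = \sum_(g <- s) f g.
Proof.
case: hR => -[_ _ /(_ a) dec _] _; case: dec => [|s [f [_ hf ->]]].
  by rewrite inE.
by exists s, f; split=> // g; have := hf g; rewrite inE.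
Qed.

Lemma homogeneousM a b :
  homogeneous gr a -> homogeneous gr b -> homogeneous gr (a * b).
Proof.
case: hR => _ hM [g _ ga] [h _ hb]; exists (g * h)%g => //.
by have := hM g h a b; rewrite !inE; apply.
Qed.

(** The elements of [A] whose homogeneous components may be chosen in [A]; the
    ideal [A] is graded when these are all its elements. *)
Definition decomposable (A : set R) : set R :=
  [set a | exists (s : seq G) (f : G -> R),
    [/\ uniq s, forall g, (A `&` gr g) (f g) & a = \sum_(g <- s) f g]].

Lemma decomposable_homogeneous (A : set R) a :
  additive_subgroup A -> A a -> homogeneous gr a -> decomposable A a.
Proof.
move=> hA Aa [g _ ga]; exists [:: g], (fun h => if h == g then a else 0).
split=> // [h|]; last by rewrite big_seq1 eqxx.
case: eqP => [->|_]; first by split.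
by split; apply: additive_subgroup0 => //; exact: grading_additive.
Qed.

(** Cutting the components off outside a support allows it to be enlarged, so
    that two decompositions can be written over one common support. *)
Lemma decomposable_additive (A : set R) :
  additive_subgroup A -> additive_subgroup (decomposable A).
Proof.
move=> hA; have hAg g : additive_subgroup (A `&` gr g).
  exact: additive_subgroupI hA (grading_additive g).
split=> [|a b]; rewrite !inE.
  exists [::], (fun=> 0); rewrite big_nil; split=> // g.
  exact: (additive_subgroup0 (hAg g)).
move=> [s [f [us hf ->]]] [t [k [ut hk ->]]].
pose cut (l : seq G) (h : G -> R) g := if g \in l then h g else 0.
have cut_in l h g : (A `&` gr g) (h g) -> (A `&` gr g) (cut l h g).
  by rewrite /cut; case: ifP => // _ _; exact: (additive_subgroup0 (hAg g)).
have cut_sum (l m : seq G) h : uniq l -> uniq m -> {subset l <= m} ->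
    \sum_(g <- l) h g = \sum_(g <- m) cut l h g.
  move=> ul um lm; rewrite /cut -big_mkcond -[RHS]big_filter.
  apply: perm_big; apply: uniq_perm => //; first exact: filter_uniq.
  move=> g; rewrite mem_filter; case: (boolP (g \in l)) => //= gl.
  by rewrite lm.
exists (undup (s ++ t)), (fun g => cut s f g - cut t k g).
split=> [|g|]; first exact: undup_uniq.
  by apply: (additive_subgroupB (hAg g)); apply: cut_in.
rewrite sumrB; congr (_ - _); apply: cut_sum; rewrite ?undup_uniq // => g gl.
  by rewrite mem_undup mem_cat gl.
by rewrite mem_undup mem_cat gl orbT.
Qed.

(** Components in [I] of degree [g] are in particular of degree [g] in [R], so
    uniqueness of decompositions is inherited from [R]. *)
Lemma graded_ideal_decomposable (I : set R) :
  two_sided_ideal I -> I `<=` decomposable I -> graded_ideal gr I.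
Proof.
move=> hI hd; have [hA _] := hI; split=> //; split=> //.
- move=> g; split; first exact: additive_subgroupI hA (grading_additive g).
  by move=> a [].
- move=> a; rewrite inE => /hd[s [f [us hf ->]]].
  by exists s, f; split=> // g; rewrite inE.
- case: hR => -[_ _ _ indep] _ s f us hf; apply: indep => // g.
  by have := hf g; rewrite !inE => -[].
Qed.

(** Inside [I = (A)], the decomposable elements form an ideal: a product of a
    ring element with a decomposable one expands into products of homogeneous
    elements, which lie in [I].  This ideal contains [A], so it is [I]. *)
Lemma graded_ideal_gen (A : set R) :
  A `<=` homogeneous gr -> graded_ideal gr (ideal_gen A).
Proof.
move=> hA; have hI := ideal_gen_ideal A; have [hIa _] := hI.
have hD := decomposable_additive hIa.
apply: graded_ideal_decomposable => //.
apply: ideal_gen_sub => [|a Aa]; last first.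
  by apply: decomposable_homogeneous => //; [exact: sub_ideal_gen|exact: hA].
apply: two_sided_idealP.
- exact: additive_subgroup0.
- by move=> a b; exact: additive_subgroupB.
- move=> r _ [s [f [_ hf ->]]]; have [t [k [hk ->]]] := grading_decomp r.
  rewrite mulr_sumr; apply: additive_subgroup_sum => // g.
  rewrite mulr_suml; apply: additive_subgroup_sum => // h.
  have [Ifg gfg] := hf g; apply: decomposable_homogeneous => //.
    exact: (two_sided_idealMl hI).
  by apply: homogeneousM; [exists h|exists g].
- move=> r _ [s [f [_ hf ->]]]; have [t [k [hk ->]]] := grading_decomp r.
  rewrite mulr_sumr; apply: additive_subgroup_sum => // h.
  rewrite mulr_suml; apply: additive_subgroup_sum => // g.
  have [Ifg gfg] := hf g; apply: decomposable_homogeneous => //.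
    exact: (two_sided_idealMr hI).
  by apply: homogeneousM; [exists g|exists h].
Qed.

End Grading.

(** * Weakly prime implies weakly 2-absorbing *)

Theorem proposition2p6 (G : groupType) (R : pzRingType) (gr : G -> set R)
    (hR : is_grading gr) (P : set R) (hP : proper_graded_ideal gr P) :
  graded_weakly_prime gr P -> graded_weakly_2_absorbing gr P.
Proof.
move=> [_ prime]; split=> // x y z; rewrite !inE => hx hy hz nz sub.
have [[hPi _] _] := hP.
set A := [set x]; set B := [set y * s * z | s in homogeneous gr].
have IA : graded_ideal gr (ideal_gen A).
  by apply: graded_ideal_gen => // _ ->.
have JB : graded_ideal gr (ideal_gen B).
  apply: graded_ideal_gen => // _ [s hs <-].
  by apply: homogeneousM => //; apply: homogeneousM.
have [Ja _] := ideal_gen_ideal B.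
have yRz s : ideal_gen B (y * s * z).
  have [l [f [hf ->]]] := grading_decomp hR s.
  rewrite mulr_sumr mulr_suml; apply: (additive_subgroup_sum Ja) => g.
  by apply: sub_ideal_gen; exists (f g) => //; exists g.
have Ix : ideal_gen A x by apply: sub_ideal_gen.
have [| |IP|JP] := prime _ _ IA JB.
- move=> IJ0; apply: nz; rewrite predeqE => u; split.
    move=> [r _ [s _ <-]]; rewrite -IJ0; apply: sub_gen_smallest.
    exists (x * r); first exact: (two_sided_idealMr (ideal_gen_ideal A)).
    by exists (y * s * z); rewrite ?mulrA.
  by move=> ->; exists 0 => //; exists 0 => //; rewrite !(mulr0, mul0r).
- apply: ideal_gen_mul_sub => // _ r _ -> [s _ <-].
  by apply: sub; exists r => //; exists s; rewrite ?mulrA.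
- by apply: Or31; apply: two_sided_idealMr => //; exact: IP.
- by apply: Or32; rewrite -[y]mulr1; apply: JP; exact: yRz.
Qed.
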